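(* Define subsets $I,S_1,S_2\subseteq\mathbb{G}[t]$ as follows: \begin{itemize} \item $I$ is the set of all linear combinations of elements of $T_{iso}$; \item $S_1$ is the set of all linear combinations of elements of $T_{loop}\cup T_{multi}$; \item $S_2$ is the set of all linear combinations of elements of $T_{os+}$, \end{itemize} where linear combinations are taken with coefficients in $\mathbb{C}[t]$. Then $\mathrm{Span}(I,S_1,S_2)=Ker(XB)$.
   Context: Write $[n]=\{1,\dots,n\}$. A graph is a finite vertex set $V(G)$ together with a finite multiset $E(G)$ of unordered pairs of not necessarily distinct vertices (loops and multi-edges are allowed). $\mathbb{G}$ is the $\mathbb{C}$-vector space freely generated by all (labelled) graphs whose vertex set is $[n]$ for some $n\ge1$, together with a zero graph (the graph with no vertices). $\mathbb{G}[t]$ consists of formal linear combinations of these graphs with coefficients in $\mathbb{C}[t]$. Tutte symmetric function: for a graph $G$, $XB_G(t;x_1,x_2,\dots)=\sum_{\kappa}(1+t)^{e(\kappa)}\prod_{v\in V(G)}x_{\kappa(v)}\in\Lambda[t]$, where the sum is over all maps $\kappa:V(G)\to\{1,2,3,\dots\}$, $e(\kappa)$ is the number of edges of $G$ (with multiplicity; every loop is counted) whose endpoints receive the same value under $\kappa$, and $\Lambda[t]$ is the ring of polynomials in $t$ over the algebra $\Lambda$ of symmetric functions over $\mathbb{C}$ in $x_1,x_2,\dots$. Extend $\mathbb{C}[t]$-linearly to $XB:\mathbb{G}[t]\to\Lambda[t]$, with kernel $Ker(XB)$. Extension: for a graph $G$ and a multiset $E$ of edges with endpoints in $V(G)$,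 $G\uplus E$ is the graph with vertex set $V(G)$ and edge multiset $E(G)\uplus E$ (multiplicities are added). For $L=\sum_{i} c_i(t)H_i$ with all $H_i$ graphs on $[n]$ and a graph $G$ on $[N]$, $N\ge n$, set $Ext(L;G)=\sum_i c_i(t)\,(G\uplus E(H_i))$. In what follows, for a multiset $E$ of edges on $[n]$ write $([n],E)$ for the graph with vertex set $[n]$ and edge multiset $E$. Define the elements of $\mathbb{G}[t]$ $$\ell_{loop}=([1],\{11\})-(t+1)\,([1],\emptyset),$$ $$\ell_{multi}=([2],\{12,12\})-(t+2)\,([2],\{12\})+(t+1)\,([2],\emptyset),$$ $$\ell_{os+}=([3],\{12,23\})+([3],\{13\})-([3],\{12\})-([3],\{13,23\}).$$ $T_{iso}$ is the set of all elements $G-H$ where $G,H$ are labelled graphs (basis elements of $\mathbb{G}$) that are isomorphic as unlabelled graphs. $T_{loop}$, $T_{multi}$, $T_{os+}$ are the sets of all elements of the form $Ext(\ell_{loop};G)$, $Ext(\ell_{multi};G)$, $Ext(\ell_{os+};G)$ respectively, where $G$ ranges over all graphs with vertex set $[N]$, with $N\ge 1$, $N\ge2$, $N\ge3$ respectively. *)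

(* Defs.v *)
From HB Require Import structures.
From mathcomp Require Import all_boot all_order all_algebra.
From mathcomp Require Import finmap multiset.
From mathcomp Require Import boolp classical_sets functions cardinality fsbigop.
From mathcomp Require Import reals.
From mathcomp Require Import complex.
From mathcomp Require Import monalg.

Set Implicit Arguments.
Unset Strict Implicit.
Unset Printing Implicit Defensive.

Import Order.TTheory GRing.Theory Num.Theory.

Local Open Scope ring_scope.
Local Open Scope classical_set_scope.

(* The vertex set [n] = {1, ..., n} is 'I_n: the vertex labelled i is the     *)
(* ordinal i - 1.  An unordered pair of not necessarily distinct vertices is  *)
(* a set of one (loop) or two vertices.                                       *)
Definition edge (n : nat) := {e : {set 'I_n} | 0 < #|e| <= 2}%N.

Lemma edge_pair_subproof n (u v : 'I_n) : (0 < #|[set u; v]%SET| <= 2)%N.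
Proof. by rewrite cards2; case: (u != v). Qed.

Definition edge_pair n (u v : 'I_n) : edge n :=
  exist _ [set u; v]%SET (edge_pair_subproof u v).

(* The edge kl of a graph on [n.+1], with the labels k, l in {1, ..., n.+1}. *)
Definition lab_edge {n : nat} (k l : nat) : edge n.+1 :=
  edge_pair (inord k.-1) (inord l.-1).

Lemma edge_map_subproof n m (f : 'I_n -> 'I_m) (e : edge n) :
  (0 < #|(f @: val e)%SET| <= 2)%N.
Proof.
case: e => e /= /andP[e_gt0 e_le2].
rewrite (leq_trans (leq_imset_card _ _) e_le2) andbT card_gt0.
by rewrite imset_eq0 -card_gt0.
Qed.

Definition edge_map n m (f : 'I_n -> 'I_m) (e : edge n) : edge m :=
  exist _ (f @: val e)%SET (edge_map_subproof f e).

Definition edges_map n m (f : 'I_n -> 'I_m) (E : {mset edge n}%mset) :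
    {mset edge m}%mset :=
  seq_mset [seq edge_map f e | e <- E].

(* A labelled graph on some [n]; the one with n = 0 is the zero graph. *)
Definition lgraph := {n : nat & {mset edge n}%mset}.

HB.instance Definition _ := Choice.on lgraph.

Definition mkgraph n (E : {mset edge n}%mset) : lgraph :=
  existT (fun n => {mset edge n}%mset) n E.
Definition nverts (G : lgraph) : nat := tag G.
Definition edges (G : lgraph) : {mset edge (nverts G)}%mset := tagged G.

Definition graph_iso (G H : lgraph) : Prop :=
  exists2 f : 'I_(nverts G) -> 'I_(nverts H),
    bijective f & edges H = edges_map f (edges G).

(* G (+) E(H), for H a graph on [n], G a graph on [N] and n <= N (the value   *)
(* is irrelevant when N < n).                                                 *)
Definition graph_add (G H : lgraph) : lgraph :=
  if @idP (nverts H <= nverts G)%N is ReflectT le_HG then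
    mkgraph (edges G `+` edges_map (widen_ord le_HG) (edges H))%mset
  else G.

(* The colour c : nat stands for the variable x_(c+1). *)
Definition monochromatic n (kappa : {ffun 'I_n -> nat}) (e : edge n) : bool :=
  [forall u in val e, forall v in val e, kappa u == kappa v].

Definition num_mono n (E : {mset edge n}%mset) (kappa : {ffun 'I_n -> nat}) :
    nat :=
  count (monochromatic kappa) E.

Definition colour_monom n (kappa : {ffun 'I_n -> nat}) : {cmonom nat} :=
  \big[mmul/mone]_(v < n) ucm (kappa v).

Lemma colour_monomE n (kappa : {ffun 'I_n -> nat}) c :
  colour_monom kappa c = (\sum_(v < n) (kappa v == c))%N.
Proof.
rewrite /colour_monom (big_morph (fun m : {cmonom nat} => m c)
  (id1 := 0%N) (op1 := addn)) ?cm1 //; last by move=> m1 m2; rewrite cmM.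
by apply: eq_bigr => v _; rewrite cmU.
Qed.

Lemma finite_colourings n (m : {cmonom nat}) :
  finite_set [set kappa : {ffun 'I_n -> nat} | colour_monom kappa = m].
Proof.
pose emb (g : {ffun 'I_n -> finsupp m}) : {ffun 'I_n -> nat} :=
  [ffun v => val (g v)].
apply: (@sub_finite_set _ _ (emb @` setT)); last exact: finite_image.
move=> kappa /= km.
have kP v : kappa v \in finsupp m.
  by rewrite -cmE_neq0 -km colour_monomE (bigD1 v) //= eqxx.
exists [ffun v => FSetSub (kP v)] => //.
by apply/ffunP => v; rewrite !ffunE.
Qed.

(* Elements of the ring C[t][[x_1, x_2, ...]], as families of coefficients. *)
Notation powser R := ({cmonom nat} -> {poly R[i]}).

(* The free C[t]-module on the labelled graphs, with C = R[i] and t = 'X. *)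
Notation Gt R := {malg {poly R[i]}[lgraph]}.

Section TutteSymmetricFunction.
Variable R : realType.

(* The sum over all kappa, grouped by monomials: each coefficient is a finite *)
(* sum by finite_colourings.                                                  *)
Definition XBgraph (G : lgraph) : powser R := fun m =>
  \sum_(kappa \in [set kappa : {ffun 'I_(nverts G) -> nat} |
                     colour_monom kappa = m])
    ((1 + 'X) ^+ num_mono (edges G) kappa : {poly R[i]}).

Definition XB (L : Gt R) : powser R := fun m =>
  \sum_(G <- msupp L) L@_G * XBgraph G m.

Definition KerXB : set (Gt R) := [set L | forall m, XB L m = 0].

(* Lambda[t], the codomain of XB (XB_Lambda_t). *)
Definition Lambda_t : set (powser R) := [set F : powser R |
  [/\ forall (s : nat -> nat) (m m' : {cmonom nat}), bijective s ->
        (forall c, m' (s c) = m c) -> F m' = F m,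
      exists d : nat, forall m, (d < mdeg m)%N -> F m = 0 &
      exists d : nat, forall m, (size (F m) <= d)%N]].

(* For L supported on graphs on [n] and G on [N] with n <= N. *)
Definition Ext (L : Gt R) (G : lgraph) : Gt R :=
  \sum_(H <- msupp L) L@_H *: << graph_add G H >>.

Definition lincomb (A : set (Gt R)) : set (Gt R) := [set x |
  exists (k : nat) (c : 'I_k -> {poly R[i]}) (a : 'I_k -> Gt R),
    (forall i, A (a i)) /\ x = \sum_(i < k) c i *: a i].

Definition gr n (s : seq (edge n)) : Gt R := << mkgraph (seq_mset s) >>.

Definition ell_loop : Gt R :=
  gr (n := 1) [:: lab_edge 1 1] - ('X + 1) *: gr (n := 1) [::].

Definition ell_multi : Gt R :=
  gr (n := 2) [:: lab_edge 1 2; lab_edge 1 2]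
  - ('X + 2%:R) *: gr (n := 2) [:: lab_edge 1 2]
  + ('X + 1) *: gr (n := 2) [::].

Definition ell_osp : Gt R :=
  gr (n := 3) [:: lab_edge 1 2; lab_edge 2 3] + gr (n := 3) [:: lab_edge 1 3]
  - gr (n := 3) [:: lab_edge 1 2]
  - gr (n := 3) [:: lab_edge 1 3; lab_edge 2 3].

Definition T_iso : set (Gt R) :=
  [set x | exists2 GH : lgraph * lgraph,
             graph_iso GH.1 GH.2 & x = << GH.1 >> - << GH.2 >>].

Definition T_loop : set (Gt R) :=
  [set Ext ell_loop G | G in [set G | (1 <= nverts G)%N]].

Definition T_multi : set (Gt R) :=
  [set Ext ell_multi G | G in [set G | (2 <= nverts G)%N]].

Definition T_osp : set (Gt R) :=
  [set Ext ell_osp G | G in [set G | (3 <= nverts G)%N]].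

Lemma XBgraph_sym (G : lgraph) (s : nat -> nat) (m m' : {cmonom nat}) :
  bijective s -> (forall c, m' (s c) = m c) -> XBgraph G m' = XBgraph G m.
Proof.
move=> [s' sK s'K] mm'; rewrite /XBgraph.
have monom_s (kappa : {ffun 'I_(nverts G) -> nat}) c :
    colour_monom [ffun v => s (kappa v)] (s c) = colour_monom kappa c.
  by rewrite !colour_monomE; apply: eq_bigr => v _; rewrite ffunE (can_eq sK).
pose h (kappa : {ffun 'I_(nverts G) -> nat}) : {ffun 'I_(nverts G) -> nat} :=
  [ffun v => s (kappa v)].
rewrite (@reindex_fsbig _ _ _ _ _ h
  [set kappa : {ffun 'I_(nverts G) -> nat} | colour_monom kappa = m]);
  last first.
  split.
  - move=> kappa /= km; apply/eqP/cmP => c.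
    by rewrite -[c]s'K monom_s km mm'.
  - move=> k1 k2 _ _ /ffunP k12; apply/ffunP => v.
    by have := k12 v; rewrite !ffunE => /(can_inj sK).
  - move=> kappa /= km; exists [ffun v => s' (kappa v)].
      apply/eqP/cmP => c; rewrite -mm' -km -monom_s.
      by congr (colour_monom _ _); apply/ffunP => v; rewrite !ffunE s'K.
    by apply/ffunP => v; rewrite !ffunE s'K.
apply: eq_fsbigr => kappa _; congr (_ ^+ _).
apply: eq_count => e; apply: eq_forallb => u; congr (_ ==> _).
by apply: eq_forallb => v; rewrite !ffunE (can_eq sK).
Qed.

Lemma XBgraph_homog (G : lgraph) m : mdeg m != nverts G -> XBgraph G m = 0.
Proof.
move=> mG; apply: fsbig1 => kappa /= km; case/eqP: mG.
rewrite -km mdeg_prod (eq_bigr (fun=> 1%N)) => [|v _]; last exact: mdegU.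
by rewrite sum_nat_const card_ord muln1.
Qed.

Lemma size_XBgraph (G : lgraph) m :
  (size (XBgraph G m) <= (size (edges G)).+1)%N.
Proof.
rewrite /XBgraph (fsbig_finite _ _ (@finite_colourings _ m)).
apply: leq_trans (size_sum _ _ _) _; apply/bigmax_leqP_seq => kappa _ _.
rewrite addrC -[1]polyC1 -[1%:P]opprK -polyCN size_exp_XsubC ltnS.
exact: count_size.
Qed.

Lemma XB_Lambda_t (L : Gt R) : Lambda_t (XB L).
Proof.
split=> [s m m' s_bij mm'||].
- by apply: eq_bigr => G _; rewrite (XBgraph_sym _ s_bij mm').
- exists (\max_(G <- msupp L) nverts G)%N => m lt_m.
  rewrite /XB big_seq big1 // => G GL; rewrite XBgraph_homog ?mulr0 //.
  apply: contraTneq lt_m => ->.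
  by rewrite -leqNgt (leq_bigmax_seq (F := nverts)).
- exists (\max_(G <- msupp L) (size (L@_G) + (size (edges G)).+1))%N => m.
  apply: leq_trans (size_sum _ _ _) _; apply/bigmax_leqP_seq => G GL _.
  apply: leq_trans (size_polyMleq _ _) _.
  apply: leq_trans (leq_pred _) _.
  apply: leq_trans (leq_add (leqnn _) (size_XBgraph G m)) _.
  by rewrite (leq_bigmax_seq
    (F := fun G => (size (L@_G) + (size (edges G)).+1)%N)).
Qed.

End TutteSymmetricFunction.

(* Main.v *)
(* Put q = 1 + t.  The labelled form of the last relation says that, modulo
   graphs with fewer edges, an edge uv may be slid to uw as soon as vw is another
   edge of the graph; loops and double edges also reduce to fewer edges.  Hence,
   modulo the relations, every graph is a combination of star forests.

   A star forest is encoded by an idempotent map r, sending each vertex to the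
   centre of its star.  In XB, the q-degree of the coefficient of a monomial is
   at most the number of edges of the graph, and for the star forest of r this
   bound is attained only by colourings constant on the stars.  Given a relation
   between pairwise non-isomorphic star forests, pick r maximizing
   deg(coefficient) + #edges, and then minimizing #edges: the top q-coefficient
   at the monomial of the colouring r only receives contributions from star
   forests isomorphic to that of r, a contradiction. *)

From HB Require Import structures.
Require Import Defs.
From mathcomp Require Import all_boot all_order all_algebra fingroup perm.
From mathcomp Require Import finmap multiset.
From mathcomp Require Import boolp classical_sets cardinality fsbigop.
From mathcomp Require Import reals complex monalg.
From mathcomp Require Import ring zify.
Set Implicit Arguments.
Unset Strict Implicit.
Unset Printing Implicit Defensive.

Import GRing.Theory Num.Theory.
Local Open Scope ring_scope.
Local Open Scope classical_set_scope.

(** * Free modules and linear combinations *)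

Section LinearExtension.
Variables (K : choiceType) (A : nzRingType) (V : lmodType A) (h : K -> V).

(** [Ext] in its first argument and each coefficient of [XB] are convertible to instances of this
    map, so both inherit linearity from it. *)
Definition linext (g : {malg A[K]}) : V := \sum_(k <- msupp g) g@_k *: h k.

Lemma linextEw (d : {fset K}) (g : {malg A[K]}) :
  (msupp g `<=` d)%fset -> linext g = \sum_(k <- d) g@_k *: h k.
Proof.
move=> le_gd; rewrite /linext (big_fset_incl _ le_gd) // => k _ kg.
by rewrite mcoeff_outdom // scale0r.
Qed.

Lemma linext_is_linear : linear linext.
Proof.
move=> a f g; pose d := (msupp f `|` msupp g)%fset.
have fd : (msupp f `<=` d)%fset by apply: fsubsetUl.
have gd : (msupp g `<=` d)%fset by apply: fsubsetUr.
have fgd : (msupp (a *: f + g) `<=` d)%fset.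
  apply: fsubset_trans (msuppD_le _ _) _.
  by apply: fsetSU; apply: msuppZ_le.
rewrite (linextEw fd) (linextEw gd) (linextEw fgd) scaler_sumr -big_split /=.
by apply: eq_bigr => k _; rewrite mcoeffD mcoeffZ scalerDl scalerA.
Qed.

HB.instance Definition _ :=
  GRing.isLinear.Build A {malg A[K]} V *:%R linext linext_is_linear.

Lemma linextU k : linext << k >> = h k.
Proof. by rewrite /linext msuppU oner_eq0 big_seq_fset1 mcoeffUU scale1r. Qed.

End LinearExtension.

Section Lincomb.
Variables (R : realType) (A : set (Gt R)).

Lemma lincomb_sub : A `<=` lincomb A.
Proof.
move=> x Ax; exists 1%N, (fun=> 1), (fun=> x); split=> //.
by rewrite big_ord1 scale1r.
Qed.

Lemma lincomb0 : lincomb A 0.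
Proof.
exists 0%N, (fun=> 0), (fun=> 0); split; first by case.
by rewrite big_ord0.
Qed.

Lemma lincombD x y : lincomb A x -> lincomb A y -> lincomb A (x + y).
Proof.
move=> [k [c [a [aA ->]]]] [l [d [b [bA ->]]]]; exists (k + l)%N.
exists (fun i => match split i with inl i => c i | inr i => d i end).
exists (fun i => match split i with inl i => a i | inr i => b i end).
split=> [i|]; first by case: (split i).
have splitl i : split (lshift l i) = inl i := unsplitK (inl i).
have splitr i : split (rshift k i) = inr i := unsplitK (inr i).
rewrite big_split_ord /=.
rewrite [in RHS](eq_bigr (fun i => c i *: a i)) => [|i _]; last by rewrite splitl.
by rewrite [X in _ = _ + X](eq_bigr (fun i => d i *: b i)) => [|i _]; last rewrite splitr.
Qed.

Lemma lincombZ c x : lincomb A x -> lincomb A (c *: x).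
Proof.
move=> [k [d [a [aA ->]]]]; exists k, (fun i => c * d i), a; split=> //.
by rewrite scaler_sumr; apply: eq_bigr => i _; rewrite scalerA.
Qed.

Lemma lincombN x : lincomb A x -> lincomb A (- x).
Proof. by rewrite -scaleN1r; apply: lincombZ. Qed.

Lemma lincomb_sum (I : Type) (s : seq I) (P : pred I) (F : I -> Gt R) :
  (forall i, P i -> lincomb A (F i)) -> lincomb A (\sum_(i <- s | P i) F i).
Proof. by move=> FA; elim/big_ind: _; [exact: lincomb0|exact: lincombD|]. Qed.

Lemma lincomb_min (B : set (Gt R)) :
  B 0 -> (forall x y, B x -> B y -> B (x + y)) ->
  (forall c x, B x -> B (c *: x)) -> A `<=` B -> lincomb A `<=` B.
Proof.
move=> B0 BD BZ AB x [k [c [a [aA ->]]]].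
by elim/big_ind: _ => [//|y z|i _]; [exact: BD|apply: BZ; apply: AB].
Qed.

End Lincomb.

(** * Edge multisets as lists, and relabelling of vertices *)

Section EdgeLists.

Lemma edge_map_comp n m p (f : 'I_n -> 'I_m) (g : 'I_m -> 'I_p) (e : edge n) :
  edge_map g (edge_map f e) = edge_map (g \o f) e.
Proof. by apply: val_inj; apply/esym/imset_comp. Qed.

Lemma eq_edge_map n m (f g : 'I_n -> 'I_m) : f =1 g -> edge_map f =1 edge_map g.
Proof. by move=> fg e; apply: val_inj; apply: eq_imset. Qed.

Lemma edge_map_id n (e : edge n) : edge_map id e = e.
Proof. by apply: val_inj; apply: imset_id. Qed.

Lemma edge_map_pair n m (f : 'I_n -> 'I_m) u v :
  edge_map f (edge_pair u v) = edge_pair (f u) (f v).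
Proof. by apply: val_inj => /=; rewrite imsetU1 imset_set1. Qed.

Lemma edge_pairC n (u v : 'I_n) : edge_pair u v = edge_pair v u.
Proof. by apply: val_inj => /=; rewrite finset.setUC. Qed.

Lemma seq_mset_cat (T : choiceType) (s t : seq T) :
  (seq_mset (s ++ t) = seq_mset s `+` seq_mset t)%mset.
Proof. by apply/msetP => x; rewrite msetE2 !mset_seqE count_cat. Qed.

Lemma edges_map_seq n m (f : 'I_n -> 'I_m) (s : seq (edge n)) :
  edges_map f (seq_mset s) = seq_mset (map (edge_map f) s).
Proof. by apply/eq_seq_msetP; apply: perm_map; apply: perm_eq_seq_mset. Qed.

Lemma eq_edges_map n m (f g : 'I_n -> 'I_m) : f =1 g -> edges_map f =1 edges_map g.
Proof.
move=> fg E; rewrite /edges_map; congr seq_mset.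
exact/eq_map/eq_edge_map.
Qed.

(** Any [f] preserving the underlying numbers will do, since [graph_add] builds its [widen_ord] from
    a proof hidden in [idP]. *)
Lemma graph_add_seq n N (s : seq (edge n)) (t : seq (edge N)) (f : 'I_n -> 'I_N) :
  (n <= N)%N -> (forall i, f i = i :> nat) ->
  graph_add (mkgraph (seq_mset t)) (mkgraph (seq_mset s)) =
    mkgraph (seq_mset (map (edge_map f) s ++ t)).
Proof.
move=> nN fE; rewrite /graph_add.
case: {-}_ / idP => [le|]; last by rewrite /= nN.
have -> : edges_map (widen_ord le) (edges (mkgraph (seq_mset s))) =
    seq_mset (map (edge_map f) s).
  rewrite -edges_map_seq; apply: eq_edges_map => i.
  by apply: val_inj; rewrite /= fE.
by congr mkgraph; rewrite seq_mset_cat msetDC.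
Qed.

Lemma perm_extend (T : finType) (s1 s2 : seq T) :
  uniq s1 -> uniq s2 -> size s1 = size s2 ->
  exists p : {perm T}, map p s1 = s2.
Proof.
elim: s1 s2 => [|x s1 IH] [|y s2] //=; first by exists 1%g.
move=> /andP[xs1 us1] /andP[ys2 us2] [/(IH _ us1 us2)[p ps]].
(* The transposition redirects [p x] to [y]. It fixes the images of [s1], which avoid [p x] by
   injectivity and [y] because [y :: s2] has no repetition. *)
exists (p * tperm (p x) y)%g; rewrite permM tpermL; congr (_ :: _).
rewrite -[RHS]ps; apply/eq_in_map => z zs; rewrite permM tpermD //.
  by apply: contraNneq xs1 => /perm_inj ->.
by apply: contraNneq ys2 => ->; rewrite -ps map_f.
Qed.

Lemma perm_widen n N (f : 'I_n -> 'I_N) (nN : (n <= N)%N) : injective f ->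
  exists p : {perm 'I_N}, forall i, p (widen_ord nN i) = f i.
Proof.
move=> f_inj.
have [||| p pE] := @perm_extend _ (map (widen_ord nN) (enum 'I_n))
    (map f (enum 'I_n)).
- by rewrite map_inj_uniq ?enum_uniq // => i j /(congr1 val) /= /val_inj.
- by rewrite map_inj_uniq ?enum_uniq.
- by rewrite !size_map.
exists p => i; move: pE; rewrite -map_comp => /eq_in_map /(_ i).
by rewrite mem_enum => /(_ isT).
Qed.

End EdgeLists.

(** * The relations placed on arbitrary vertices *)

Section Relations.
Variable R : realType.

Definition relspan : set (Gt R) :=
  lincomb (lincomb (@T_iso R) `|` lincomb (@T_loop R `|` @T_multi R) `|`
           lincomb (@T_osp R)).

Lemma gr_perm n (s t : seq (edge n)) : perm_eq s t -> gr R s = gr R t.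
Proof. by rewrite /gr => /eq_seq_msetP ->. Qed.

Lemma relspan_iso G H : graph_iso G H -> relspan (<< G >> - << H >>).
Proof.
move=> GH; apply: lincomb_sub; left; left.
by apply: lincomb_sub; exists (G, H).
Qed.

Lemma relspan_perm n (p : {perm 'I_n}) (s : seq (edge n)) :
  relspan (gr R (map (edge_map p) s) - gr R s).
Proof.
rewrite -opprB; apply: lincombN; apply: relspan_iso; exists p => /=.
  exact: injF_bij (@perm_inj _ p).
by rewrite /= edges_map_seq.
Qed.

Lemma ExtE (L : Gt R) (G : lgraph) :
  Ext L G = linext (fun H : lgraph => << graph_add G H >>) L.
Proof. by []. Qed.

Lemma Ext_sum_gr n N (r : seq ({poly R[i]} * seq (edge n))) (t : seq (edge N))
    (nN : (n <= N)%N) :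
  Ext (\sum_(p <- r) p.1 *: gr R p.2) (mkgraph (seq_mset t)) =
    \sum_(p <- r) p.1 *: gr R (map (edge_map (widen_ord nN)) p.2 ++ t).
Proof.
rewrite ExtE linear_sum; apply: eq_bigr => p _.
by rewrite linearZ /= linextU (@graph_add_seq _ _ _ _ (widen_ord nN)).
Qed.

(** [Ext] places a relation on the first [n] labels only; modulo [T_iso] it can be moved along any
    injection. The context [s] is pulled back by a permutation [p] extending [f], the relation is
    extended there, and every term is carried back by [p]. *)
Lemma relspan_relabel n N (f : 'I_n -> 'I_N) (r : seq ({poly R[i]} * seq (edge n)))
    (s : seq (edge N)) :
  injective f ->
  (forall G, (n <= nverts G)%N -> relspan (Ext (\sum_(p <- r) p.1 *: gr R p.2) G)) ->
  relspan (\sum_(p <- r) p.1 *: gr R (map (edge_map f) p.2 ++ s)).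
Proof.
move=> f_inj Hr.
have nN : (n <= N)%N by rewrite -[n]card_ord -[N]card_ord; apply: leq_card f_inj.
have [p pE] := perm_widen nN f_inj.
pose t := map (edge_map (p^-1)%g) s.
have := Hr (mkgraph (seq_mset t)) nN; rewrite (Ext_sum_gr r t nN).
move=> Ht; rewrite -[X in relspan X](subrK (\sum_(p0 <- r) p0.1 *:
  gr R (map (edge_map (widen_ord nN)) p0.2 ++ t))).
apply: lincombD => //; rewrite -sumrB; apply: lincomb_sum => q _.
rewrite -scalerBr; apply: lincombZ.
rewrite -(_ : map (edge_map p) (map (edge_map (widen_ord nN)) q.2 ++ t) =
    map (edge_map f) q.2 ++ s); first exact: relspan_perm.
rewrite map_cat -!map_comp; congr (_ ++ _).
  by apply: eq_map => e /=; rewrite edge_map_comp; apply: eq_edge_map.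
rewrite -[RHS]map_id; apply: eq_map => e /=.
rewrite edge_map_comp -[RHS]edge_map_id; apply: eq_edge_map => i /=.
by rewrite permKV.
Qed.

End Relations.

Section SmallCombinations.
Variables (A : nzRingType) (V : lmodType A) (I : Type) (F : I -> V).

(** This and the next two lemmas put [ell_loop], [ell_multi] and [ell_osp] into the list format
    shared by [relspan_relabel] and [KerXB_sum]. *)
Lemma sum_loop_shape c i j :
  \sum_(p <- [:: (1, i); (- c, j)]) p.1 *: F p.2 = F i - c *: F j.
Proof. by rewrite !big_cons big_nil addr0 scale1r scaleNr. Qed.

Lemma sum_multi_shape c d i j k :
  \sum_(p <- [:: (1, i); (- c, j); (d, k)]) p.1 *: F p.2 =
    F i - c *: F j + d *: F k.
Proof. by rewrite !big_cons big_nil addr0 scale1r scaleNr addrA. Qed.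

Lemma sum_osp_shape i j k l :
  \sum_(p <- [:: (1, i); (1, j); (- 1, k); (- 1, l)]) p.1 *: F p.2 =
    F i + F j - F k - F l.
Proof. by rewrite !big_cons big_nil addr0 !scaleNr !scale1r !addrA. Qed.

End SmallCombinations.

Section LabelledRelations.
Variables (R : realType) (n : nat).
Implicit Types (u v w : 'I_n) (s : seq (edge n)).

Lemma relspan_loop u s :
  relspan (gr R (edge_pair u u :: s) - ('X + 1) *: gr R s).
Proof.
have f_inj : injective (fun _ : 'I_1 => u) by move=> i j _; rewrite !ord1.
pose r : seq ({poly R[i]} * seq (edge 1)) :=
  [:: (1, [:: lab_edge 1 1]); (- ('X + 1), [::])].
have E := sum_loop_shape
  (fun t : seq (edge 1) => gr R (map (edge_map (fun=> u)) t ++ s))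
  ('X + 1) [:: lab_edge 1 1] [::].
rewrite /= !edge_map_pair  in E.
apply: (eq_ind _ (@relspan R) (relspan_relabel (r := r) s f_inj _) _ E) => G G_big.
apply: lincomb_sub; left; right; apply: lincomb_sub; left.
exists G; first exact: G_big.
exact: (@congr1 _ _ ((@Ext R)^~ G) (ell_loop R) _
  (esym (sum_loop_shape (@gr R 1) ('X + 1) [:: lab_edge 1 1] [::]))).
Qed.

Lemma relspan_multi u v s : u != v ->
  relspan (gr R (edge_pair u v :: edge_pair u v :: s)
           - ('X + 2%:R) *: gr R (edge_pair u v :: s) + ('X + 1) *: gr R s).
Proof.
move=> uv; pose f (i : 'I_2) := if i == inord 0 then u else v.
have f0 : f (inord 0) = u by rewrite /f eqxx.
have f1 : f (inord 1) = v by rewrite /f -val_eqE /= !inordK.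
have f_inj : injective f.
  move=> i j; rewrite /f; case: eqVneq => [->|i0]; case: eqVneq => [->|j0] // E.
  - by rewrite E eqxx in uv.
  - by rewrite E eqxx in uv.
  apply: val_inj; move: i j i0 j0 {E} => [[|[|i]] i2] [[|[|j]] j2] //;
  by rewrite -!val_eqE /= !inordK.
pose r : seq ({poly R[i]} * seq (edge 2)) :=
  [:: (1, [:: lab_edge 1 2; lab_edge 1 2]); (- ('X + 2%:R), [:: lab_edge 1 2]);
      ('X + 1, [::])].
have E := sum_multi_shape
  (fun t : seq (edge 2) => gr R (map (edge_map f) t ++ s))
  ('X + 2%:R) ('X + 1)
  [:: lab_edge 1 2; lab_edge 1 2] [:: lab_edge 1 2] [::].
rewrite /= !edge_map_pair f0 f1 in E.
apply: (eq_ind _ (@relspan R) (relspan_relabel (r := r) s f_inj _) _ E) => G G_big.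
apply: lincomb_sub; left; right; apply: lincomb_sub; right.
exists G; first exact: G_big.
exact: (@congr1 _ _ ((@Ext R)^~ G) (ell_multi R) _
  (esym (sum_multi_shape (@gr R 2) ('X + 2%:R) ('X + 1)
  [:: lab_edge 1 2; lab_edge 1 2] [:: lab_edge 1 2] [::]))).
Qed.

Lemma relspan_osp u v w s : u != v -> v != w -> u != w ->
  relspan (gr R (edge_pair u v :: edge_pair v w :: s) + gr R (edge_pair u w :: s)
           - gr R (edge_pair u v :: s)
           - gr R (edge_pair u w :: edge_pair v w :: s)).
Proof.
move=> uv vw uw.
pose f (i : 'I_3) := if i == inord 0 then u else if i == inord 1 then v else w.
have f0 : f (inord 0) = u by rewrite /f eqxx.
have f1 : f (inord 1) = v by rewrite /f -!val_eqE /= !inordK.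
have f2 : f (inord 2) = w by rewrite /f -!val_eqE /= !inordK.
have f_inj : injective f.
  have I3 (i : 'I_3) : [\/ i = inord 0, i = inord 1 | i = inord 2].
    case: i => [[|[|[|i]]] i3] //;
    by [constructor 1; apply: val_inj; rewrite /= inordK
       |constructor 2; apply: val_inj; rewrite /= inordK
       |constructor 3; apply: val_inj; rewrite /= inordK].
  by move=> i j; case: (I3 i) => ->; case: (I3 j) => ->; rewrite ?f0 ?f1 ?f2 // => E;
    move: uv vw uw; rewrite E eqxx.
pose r : seq ({poly R[i]} * seq (edge 3)) :=
  [:: (1, [:: lab_edge 1 2; lab_edge 2 3]); (1, [:: lab_edge 1 3]);
      (- 1, [:: lab_edge 1 2]); (- 1, [:: lab_edge 1 3; lab_edge 2 3])].
have E := sum_osp_shape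
  (fun t : seq (edge 3) => gr R (map (edge_map f) t ++ s))
  [:: lab_edge 1 2; lab_edge 2 3]
  [:: lab_edge 1 3] [:: lab_edge 1 2] [:: lab_edge 1 3; lab_edge 2 3].
rewrite /= !edge_map_pair f0 f1 f2 in E.
apply: (eq_ind _ (@relspan R) (relspan_relabel (r := r) s f_inj _) _ E) => G G_big.
apply: lincomb_sub; right; apply: lincomb_sub; exists G; first exact: G_big.
exact: (@congr1 _ _ ((@Ext R)^~ G) (ell_osp R) _
  (esym (sum_osp_shape (@gr R 3) [:: lab_edge 1 2; lab_edge 2 3]
  [:: lab_edge 1 3] [:: lab_edge 1 2] [:: lab_edge 1 3; lab_edge 2 3]))).
Qed.

End LabelledRelations.

(** * Reduction to star forests *)

Section StarGraphs.
Variable n : nat.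
Implicit Types r : 'I_n -> 'I_n.

(** For idempotent [r] the fixed points are the centres, isolated vertices included; each remaining
    vertex carries exactly one edge. *)
Definition leaves r := [seq x <- enum 'I_n | r x != x].

Definition star r : seq (edge n) := [seq edge_pair x (r x) | x <- leaves r].

Lemma mem_leaves r x : (x \in leaves r) = (r x != x).
Proof. by rewrite mem_filter mem_enum andbT. Qed.

(** Joining the centre [a] to the centre [b] and redirecting to [b] all leaves of [a] gives a star
    forest again: its leaves are those of [r] together with [a]. *)
Lemma star_merge r a b : (forall x, r (r x) = r x) -> r a = a -> r b = b -> a != b ->
  let r' x := if r x == a then b else r x in
  (forall x, r' (r' x) = r' x) /\
  perm_eq (star r') (edge_pair a b :: [seq edge_pair x (r' x) | x <- leaves r]).
Proof.
move=> rr ra rb ab r'; split=> [x|].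
  rewrite /r'; case: (eqVneq (r x) a) => [rxa|rxa].
    by rewrite rb eq_sym (negPf ab).
  by rewrite rr (negPf rxa).
rewrite -[_ :: _](_ : [seq edge_pair x (r' x) | x <- a :: leaves r] = _); last first.
  by rewrite /= {1}/r' ra eqxx.
apply: perm_map; apply: uniq_perm.
- by rewrite filter_uniq ?enum_uniq.
- by rewrite /= mem_leaves ra eqxx filter_uniq ?enum_uniq.
move=> x; rewrite inE !mem_leaves /r'.
case: (eqVneq x a) => [->|xa]; first by rewrite ra eqxx eq_sym.
case: (eqVneq (r x) a) => [rxa|//].
rewrite rxa [a == x]eq_sym xa; apply/eqP => bx.
by move: rxa ab; rewrite -bx rb => ->; rewrite eqxx.
Qed.

End StarGraphs.

Section Reduction.
Variable R : realType.

Definition star_supported (L : Gt R) : Prop := forall G, G \in msupp L ->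
  exists n (r : 'I_n -> 'I_n),
    (forall x, r (r x) = r x) /\ G = mkgraph (seq_mset (star r)).

Definition starlike : set (Gt R) :=
  [set x | exists2 y, star_supported y & relspan (x - y)].

Lemma star_supportedD x y :
  star_supported x -> star_supported y -> star_supported (x + y).
Proof.
move=> sx sy G /(fsubsetP (msuppD_le _ _)); rewrite in_fsetU => /orP[].
  exact: sx.
exact: sy.
Qed.

Lemma starlike_relspan x : relspan x -> starlike x.
Proof.
move=> Rx; exists 0; last by rewrite subr0.
by move=> G; rewrite msupp0 in_fset0.
Qed.

Lemma starlikeD x y : starlike x -> starlike y -> starlike (x + y).
Proof.
move=> [x' sx Rx] [y' sy Ry]; exists (x' + y'); first exact: star_supportedD.
by rewrite opprD addrACA; apply: lincombD.
Qed.

Lemma starlikeZ c x : starlike x -> starlike (c *: x).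
Proof.
move=> [x' sx Rx]; exists (c *: x'); last first.
  by rewrite -scalerBr; apply: lincombZ.
by move=> G /(fsubsetP (msuppZ_le _ _)); apply: sx.
Qed.

Lemma starlikeN x : starlike x -> starlike (- x).
Proof. by rewrite -scaleN1r; apply: starlikeZ. Qed.

Lemma starlike_star n (r : 'I_n -> 'I_n) :
  (forall x, r (r x) = r x) -> starlike (gr R (star r)).
Proof.
move=> rr; exists (gr R (star r)); last by rewrite subrr; apply: lincomb0.
move=> G; rewrite /gr msuppU oner_eq0 in_fset1 => /eqP ->.
by exists n, r.
Qed.

Lemma starlike_loop a b p : relspan (a - p *: b) -> starlike b -> starlike a.
Proof.
move=> Rab Sb; rewrite -(subrK (p *: b) a).
by apply: starlikeD; [exact: starlike_relspan|exact: starlikeZ].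
Qed.

Lemma starlike_multi a b c p q :
  relspan (a - p *: b + q *: c) -> starlike b -> starlike c -> starlike a.
Proof.
move=> Rabc Sb Sc; rewrite -(subrK (p *: b) a) -(addrK (q *: c) (a - _)).
apply: starlikeD; last exact: starlikeZ.
apply: starlikeD; first exact: starlike_relspan.
by apply: starlikeN; apply: starlikeZ.
Qed.

Lemma starlike_exchange a b c d : relspan (a + b - c - d) ->
  starlike b -> starlike c -> starlike a -> starlike d.
Proof.
move=> Rabcd Sb Sc Sa.
rewrite -(subKr (a + b - c) d).
apply: starlikeD; last by apply: starlikeN; apply: starlike_relspan.
apply: starlikeD; last exact: starlikeN.
exact: starlikeD.
Qed.

Section FixedVertexSet.
Variable n : nat.
Implicit Types (u v w : 'I_n) (s t : seq (edge n)).

Local Notation starlike_gr s := (starlike (gr R s)).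

Lemma starlike_perm s t : perm_eq s t -> starlike_gr s -> starlike_gr t.
Proof. by move=> /(gr_perm R) ->. Qed.

Section InductionStep.
Variable k : nat.
Hypothesis IH : forall s, (size s < k)%N -> starlike_gr s.

Lemma slide u v w s : edge_pair v w \in s -> (size s < k)%N ->
  starlike_gr (edge_pair u v :: s) -> starlike_gr (edge_pair u w :: s).
Proof.
move=> /perm_to_rem; set t := rem _ _ => st lt_sk.
have szs : size s = (size t).+1 by rewrite (perm_size st).
move=> Sv; have {Sv} : starlike_gr (edge_pair u v :: edge_pair v w :: t).
  by apply: starlike_perm Sv; rewrite perm_cons.
move=> Sv; suff : starlike_gr (edge_pair u w :: edge_pair v w :: t).
  by apply: starlike_perm; rewrite perm_cons perm_sym.
have small e : starlike_gr (e :: t) by apply: IH; rewrite /= -szs.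
have St : starlike_gr t by apply: IH; move: lt_sk; rewrite szs; apply: ltnW.
have [vw|vw] := eqVneq v w; first by move: Sv; rewrite vw.
have [uw|uw] := eqVneq u w.
  by rewrite -uw; apply: starlike_loop (relspan_loop R u _) (small _).
have [uv|uv] := eqVneq u v.
  rewrite -uv; exact: starlike_multi (relspan_multi R t uw) (small _) St.
exact: starlike_exchange (relspan_osp R t uv vw uw) (small _) (small _) Sv.
Qed.

(** The edge [ab] lets each edge from a leaf to [b] be slid to [a], so the merged star can be taken
    apart again. *)
Lemma slide_leaves a b r' (r : 'I_n -> 'I_n) (l : seq 'I_n) t :
  (forall x, r' x = if r x == a then b else r x) ->
  (size l + size t < k)%N ->
  starlike_gr (edge_pair a b :: [seq edge_pair x (r' x) | x <- l] ++ t) ->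
  starlike_gr (edge_pair a b :: [seq edge_pair x (r x) | x <- l] ++ t).
Proof.
move=> r'E; elim: l t => [//|x l IHl] t lt_k Sx.
have p1 s (e f : edge n) : perm_eq (e :: f :: s) (f :: e :: s).
  by apply/seq.permP => p /=; rewrite addnCA.
have p2 s1 s2 (e f : edge n) : perm_eq (e :: f :: s1 ++ s2) (f :: s1 ++ e :: s2).
  by apply/seq.permP => p /=; rewrite !count_cat /=; lia.
have p3 s1 s2 (e f : edge n) : perm_eq (f :: s1 ++ e :: s2) (f :: e :: s1 ++ s2).
  by apply/seq.permP => p /=; rewrite !count_cat /=; lia.
(* The edge of [x] is parked in [t], which is why the induction on [l] keeps [t] general. *)
apply: (starlike_perm (p3 _ _ _ _)); apply: IHl.
  by move: lt_k; rewrite /= addSnnS.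
apply: (starlike_perm (p2 _ _ _ _)).
have := starlike_perm (p1 ([seq edge_pair x (r' x) | x <- l] ++ t)
  (edge_pair a b) (edge_pair x (r' x))) Sx.
rewrite r'E; case: eqP => [->|_]; last exact.
apply: slide; first by rewrite edge_pairC mem_head.
by move: lt_k; rewrite /= size_cat size_map.
Qed.

(** The edges of [t] are absorbed one at a time. Both ends of an edge are slid to the centres of
    their stars; there it becomes a loop, or it joins two centres and the stars are merged. *)
Lemma starlike_star_cat t (r : 'I_n -> 'I_n) : (forall x, r (r x) = r x) ->
  (size (star r) + size t <= k)%N -> starlike_gr (star r ++ t).
Proof.
elim: t r => [|e t IHt] r rr; first by rewrite cats0 => _; apply: starlike_star.
have [u [v ->]] : exists u v, e = edge_pair u v.
  case: e => e e2; have [e0|[u ue]] := set_0Vmem e.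
    by have := e2; rewrite {1}e0 cards0.
  have [eu|/set0Pn[v]] := eqVneq (e :\ u)%SET finset.set0.
    exists u, u; apply: val_inj => /=.
    by rewrite -(finset.setD1K ue) eu !finset.setUid finset.setU0.
  rewrite finset.in_setD1 => /andP[vu ve]; exists u, v; apply: val_inj => /=.
  apply/esym/eqP; rewrite eqEcard finset.subUset !finset.sub1set ue ve /=.
  by rewrite cards2 eq_sym vu; case/andP: e2.
rewrite /= addnS => lt_k.
have lt_k' : (size (star r ++ t) < k)%N by rewrite size_cat.
(* The edge from [y] to its centre [r y] is present unless [y] is a centre, and along it the new
   edge slides. *)
have to_root x y : starlike_gr (edge_pair x (r y) :: star r ++ t) ->
    starlike_gr (edge_pair x y :: star r ++ t).
  have [->|ry] := eqVneq (r y) y; first exact.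
  apply: slide; last exact: lt_k'.
  rewrite mem_cat edge_pairC (map_f (fun z => edge_pair z (r z))) //.
  by rewrite mem_leaves.
have p1 e' : perm_eq (e' :: star r ++ t) (star r ++ e' :: t).
  by rewrite perm_sym -cat1s perm_catCA.
(* One use of [to_root] for each end of the edge, with the ends swapped in between. *)
apply: (starlike_perm (p1 _)); apply: (to_root); rewrite edge_pairC.
apply: (to_root); rewrite edge_pairC.
have [->|ab] := eqVneq (r u) (r v).
  exact: starlike_loop (relspan_loop R _ _) (IH lt_k').
have [r'r' p2] := star_merge rr (rr u) (rr v) ab.
pose r' x := if r x == r u then r v else r x.
apply: (slide_leaves (r' := r')); first by [].
  by move: lt_k; rewrite size_map.
apply: starlike_perm (IHt _ r'r' _); last first.
  by rewrite (perm_size p2) /= size_map addSn; move: lt_k; rewrite size_map.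
by rewrite -cat_cons perm_cat2r.
Qed.

End InductionStep.

Lemma starlike_graph s : starlike_gr s.
Proof.
have [k] := ubnP (size s); elim: k s => // k IH s le_sk.
have star_id : star (@id 'I_n) = [::].
  by rewrite /star /leaves (eq_filter (a2 := pred0)) ?filter_pred0 // => x; rewrite /= eqxx.
(* The identity encodes the edgeless forest, into which all of [s] is absorbed. *)
rewrite -[s]/([::] ++ s) -star_id; apply: (starlike_star_cat IH); first by [].
by rewrite star_id.
Qed.

End FixedVertexSet.

Lemma starlikeT (L : Gt R) : starlike L.
Proof.
rewrite [L]monalgE; elim/big_ind: _.
- exact/starlike_relspan/lincomb0.
- exact: starlikeD.
move=> [n E] _; rewrite (_ : << _ *g _ >> = L@_(existT _ n E) *: gr R E).
  exact/starlikeZ/starlike_graph.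
rewrite /gr seq_mset_id; apply/malgP => H.
by rewrite mcoeffZ !mcoeffU mulr_natr.
Qed.

End Reduction.

(** * Isomorphisms of star forests *)

(** Two idempotent maps with the same fibres differ only in the representative of each fibre. The
    involution exchanges the two representatives of every fibre and fixes all other points. *)
Lemma same_kernel_conj (T : eqType) (r s : T -> T) :
  (forall x, r (r x) = r x) -> (forall x, s (s x) = s x) ->
  (forall x y, r x = r y <-> s x = s y) ->
  exists2 f : T -> T, involutive f & forall x, f (r x) = s (f x).
Proof.
move=> rr ss rs.
have rsE x : r (s x) = r x by apply/rs; rewrite ss.
have srE x : s (r x) = s x by apply/rs; rewrite rr.
exists (fun x => if r x == x then s x else if s x == x then r x else x) => x.
  case: (eqVneq (r x) x) => [rx|rx].
    by rewrite rsE rx ss eqxx; case: eqVneq => [<-|].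
  case: (eqVneq (s x) x) => [sx|sx]; first by rewrite rr eqxx srE sx.
  by rewrite (negPf rx) (negPf sx).
rewrite rr eqxx srE; case: (eqVneq (r x) x) => [rx|rx]; first by rewrite ss.
by case: (eqVneq (s x) x) => [sx|//]; rewrite srE.
Qed.

Section StarIso.
Variable n : nat.
Implicit Types r : 'I_n -> 'I_n.

Lemma card_leaves r : (#|[set x | r x == x]%SET| + size (leaves r) = n)%N.
Proof.
rewrite -[RHS]card_ord -(cardsC [set x | r x == x]%SET); congr (_ + _)%N.
rewrite cardE; apply: perm_size; apply: uniq_perm => [||x].
- by rewrite filter_uniq ?enum_uniq.
- exact: enum_uniq.
by rewrite mem_leaves mem_enum !finset.inE.
Qed.

Lemma size_star r : size (star r) = size (leaves r).
Proof. exact: size_map. Qed.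

Lemma star_iso r (f : 'I_n -> 'I_n) r' : bijective f ->
  (forall x, f (r x) = r' (f x)) ->
  graph_iso (mkgraph (seq_mset (star r))) (mkgraph (seq_mset (star r'))).
Proof.
move=> f_bij fr; exists f => //=; rewrite edges_map_seq; apply/eq_seq_msetP.
rewrite -map_comp (eq_map (g := (fun y => edge_pair y (r' y)) \o f)) => [|x]; last first.
  by rewrite /= edge_map_pair fr.
rewrite map_comp; apply: perm_map; apply: uniq_perm => [||y].
- by rewrite filter_uniq ?enum_uniq.
- by rewrite (map_inj_uniq (bij_inj f_bij)) filter_uniq ?enum_uniq.
case: f_bij => g fK gK; rewrite -[y]gK (mem_map (can_inj fK)) !mem_leaves.
by rewrite -fr (can_eq fK).
Qed.

Lemma colouring_perm (kappa lambda : {ffun 'I_n -> nat}) :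
  colour_monom kappa = colour_monom lambda ->
  exists p : {perm 'I_n}, forall x, lambda x = kappa (p x).
Proof.
move=> kl; have : perm_eq (mktuple lambda) (mktuple kappa).
  have cnt (mu : {ffun 'I_n -> nat}) c : count_mem c (mktuple mu) = colour_monom mu c.
    by rewrite colour_monomE /= count_map -sum1_count big_mkcond big_enum.
  by apply/allP => c _; rewrite /= !cnt kl.
case/tuple_permP => p pE; exists p => x.
have := congr1 (fun t => nth 0%N t x) pE.
by rewrite -!tnth_nth !tnth_mktuple.
Qed.

(** [kappa] uses as many colours as [r] has centres and is constant on the stars of [r'], which are
    at most as numerous. Hence distinct stars of [r'] get distinct colours, its stars are the colour
    classes, and their sizes are those of the stars of [r]. *)
Lemma star_iso_of_colouring r r' (kappa : {ffun 'I_n -> nat}) :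
  (forall x, r (r x) = r x) -> (forall x, r' (r' x) = r' x) ->
  (forall x, kappa (r' x) = kappa x) ->
  colour_monom kappa = colour_monom [ffun x => val (r x)] ->
  (size (leaves r) <= size (leaves r'))%N ->
  graph_iso (mkgraph (seq_mset (star r))) (mkgraph (seq_mset (star r'))).
Proof.
move=> rr r'r' kr' /colouring_perm[p pE] le_leaves.
have {}pE x : kappa (p x) = r x by rewrite -pE ffunE.
(* [g] is [kappa] with colours read as vertices; it maps the centres of [r'] onto those of [r], and
   counting makes this injective. *)
pose g x := r ((p^-1)%g x).
have gE x : kappa x = g x by rewrite -pE permKV.
pose A r := [set x : 'I_n | r x == x]%SET.
have gA : (g @: A r' = A r)%SET.
  apply/setP => y; apply/imsetP/idP => [[x _ ->]|].
    by rewrite finset.inE /g rr.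
  rewrite finset.inE => /eqP ry; exists (r' (p y)).
    by rewrite finset.inE r'r'.
  by apply: val_inj; rewrite /= -gE kr' pE ry.
have g_inj : {in A r' &, injective g}.
  apply/imset_injP; rewrite eqn_leq leq_imset_card gA /=.
  rewrite -(leq_add2r (size (leaves r'))) (card_leaves r').
  by rewrite -[leqLHS](card_leaves r) leq_add2l.
(* After conjugation by [p], the map [r'] has the same fibres as [r]. *)
have [||| f0 f0K f0E] := @same_kernel_conj _ r (fun x => (p^-1)%g (r' (p x))).
- exact: rr.
- by move=> x; rewrite permKV r'r'.
- move=> x y; split=> [rxy|/perm_inj r'xy].
    congr (_ _); apply: g_inj; rewrite ?finset.inE ?r'r' //.
    by apply: val_inj; rewrite /= -!gE !kr' !pE rxy.
  by apply: val_inj; rewrite /= -!pE -kr' r'xy kr'.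
apply: (star_iso (f := p \o f0)) => [|x].
  by apply: injF_bij; apply: inj_comp; [exact: perm_inj|exact: can_inj f0K].
by rewrite /= f0E permKV.
Qed.

End StarIso.

(** * The kernel of XB *)

Lemma monochromatic_pair n (kappa : {ffun 'I_n -> nat}) u v :
  monochromatic kappa (edge_pair u v) = (kappa u == kappa v).
Proof.
apply/idP/idP => [/forall_inP/(_ u)|/eqP kuv].
  rewrite /= !finset.inE eqxx /= => /(_ isT) /forall_inP/(_ v).
  by rewrite !finset.inE eqxx orbT => /(_ isT).
apply/forall_inP => x; rewrite !finset.inE => xuv.
apply/forall_inP => y; rewrite !finset.inE => yuv.
by case/orP: xuv => /eqP ->; case/orP: yuv => /eqP ->; rewrite ?kuv.
Qed.

Lemma monochromatic_map n m (f : 'I_n -> 'I_m) (kappa : {ffun 'I_m -> nat}) e :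
  monochromatic kappa (edge_map f e) = monochromatic [ffun x => kappa (f x)] e.
Proof.
apply/forall_inP/forall_inP => H x xe; apply/forall_inP => y ye.
  rewrite !ffunE.
  by have /forall_inP := H _ (imset_f f xe); apply; apply: imset_f.
case/imsetP: xe => {}x xe ->; case/imsetP: ye => {}y ye ->.
by have /forall_inP/(_ y ye) := H x xe; rewrite !ffunE.
Qed.

Section Kernel.
Variable R : realType.

Definition weight n (kappa : {ffun 'I_n -> nat}) (s : seq (edge n)) : {poly R[i]} :=
  (1 + 'X) ^+ count (monochromatic kappa) s.

Lemma weight_cat n (kappa : {ffun 'I_n -> nat}) s t :
  weight kappa (s ++ t) = weight kappa s * weight kappa t.
Proof. by rewrite /weight count_cat exprD. Qed.

Lemma weight_map n m (f : 'I_n -> 'I_m) (kappa : {ffun 'I_m -> nat}) s :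
  weight kappa (map (edge_map f) s) = weight [ffun x => kappa (f x)] s.
Proof.
rewrite /weight count_map; congr (_ ^+ _); apply: eq_count => e /=.
exact: monochromatic_map.
Qed.

Definition colourings n (m : {cmonom nat}) : {fset {ffun 'I_n -> nat}} :=
  fset_set [set kappa : {ffun 'I_n -> nat} | colour_monom kappa = m].

Lemma colouringsP n m (kappa : {ffun 'I_n -> nat}) :
  reflect (colour_monom kappa = m) (kappa \in colourings n m).
Proof.
rewrite /colourings in_fset_set; last exact: finite_colourings.
by apply: (iffP idP); rewrite inE.
Qed.

Lemma XBgraph_seq n (s : seq (edge n)) m :
  XBgraph R (mkgraph (seq_mset s)) m = \sum_(kappa <- colourings n m) weight kappa s.
Proof.
rewrite /XBgraph (fsbig_finite _ _ (@finite_colourings n m)).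
apply: eq_bigr => kappa _; congr (_ ^+ _).
exact/seq.permP/perm_eq_seq_mset.
Qed.

Lemma XBE (L : Gt R) m : XB L m = linext (fun G => XBgraph R G m : {poly R[i]}^o) L.
Proof. by []. Qed.

Lemma KerXB0 : KerXB (0 : Gt R).
Proof. by move=> m; rewrite XBE linear0. Qed.

Lemma KerXBD (x y : Gt R) : KerXB x -> KerXB y -> KerXB (x + y).
Proof.
by move=> Kx Ky m; rewrite XBE linearD /= -!XBE Kx Ky addr0.
Qed.

Lemma KerXBZ c (x : Gt R) : KerXB x -> KerXB (c *: x).
Proof.
by move=> Kx m; rewrite XBE linearZ /= -XBE Kx scaler0.
Qed.

Lemma XBgraph_iso G H : graph_iso G H -> XBgraph R G = XBgraph R H.
Proof.
case: G H => [n E] [p F] [/= f [g fK gK] /= EF]; apply/funext => m.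
change (F = edges_map f E) in EF; subst F; rewrite /XBgraph /=.
rewrite [RHS](@reindex_fsbig _ _ _ _ _ (fun kappa : {ffun 'I_n -> nat} => [ffun v => kappa (g v)])
  [set kappa : {ffun 'I_n -> nat} | colour_monom kappa = m]); last first.
  have monom (kappa : {ffun 'I_n -> nat}) :
      colour_monom [ffun v => kappa (g v)] = colour_monom kappa.
    apply/eqP/cmP => c; rewrite !colour_monomE.
    rewrite [RHS](reindex g) /=; last by exists f => x _.
    by apply: eq_bigr => v _; rewrite ffunE.
  split=> [kappa /= km|k1 k2 _ _ /ffunP k12|kappa /= km].
  - by rewrite monom.
  - by apply/ffunP => v; have := k12 (f v); rewrite !ffunE fK.
  exists [ffun v => kappa (f v)]; last by apply/ffunP => v; rewrite !ffunE gK.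
  by rewrite /= -monom -km; congr colour_monom; apply/ffunP => v; rewrite !ffunE gK.
apply: eq_fsbigr => kappa _; congr (_ ^+ _).
rewrite /num_mono (seq.permP (perm_eq_seq_mset _)) count_map.
apply: eq_count => e /=; rewrite monochromatic_map.
by congr monochromatic; apply/ffunP => v; rewrite !ffunE fK.
Qed.

(** The weight of a colouring is multiplicative over edge lists, so the factor of [G] comes out and
    only the colours of the first [n] vertices matter. *)
Lemma KerXB_sum n (r : seq ({poly R[i]} * seq (edge n))) G : (n <= nverts G)%N ->
  (forall kappa : {ffun 'I_n -> nat}, \sum_(p <- r) p.1 * weight kappa p.2 = 0) ->
  KerXB (Ext (\sum_(p <- r) p.1 *: gr R p.2) G).
Proof.
case: G => N E /= nN Hr m.
rewrite -[E]seq_mset_id Ext_sum_gr XBE linear_sum.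
rewrite (eq_bigr (fun p => \sum_(kappa <- colourings N m) p.1 *
  weight kappa (map (edge_map (widen_ord nN)) p.2) * weight kappa E)) => [|p _]; last first.
  rewrite linearZ /= linextU XBgraph_seq [LHS]mulr_sumr.
  by apply: eq_bigr => kappa _; rewrite weight_cat mulrA.
rewrite exchange_big big1 //= => kappa _; rewrite -mulr_suml.
under eq_bigr do rewrite weight_map.
by rewrite Hr mul0r.
Qed.

End Kernel.

(** [G] is traded for [H], which is in the support already: [G] is lost and nothing is gained. *)
Lemma msupp_exchange (K : choiceType) (A : nzRingType) (L : {malg A[K]}) (G H : K) :
  G <> H -> H \in msupp L ->
  (msupp (L - L@_G *: (<< G >> - << H >>)) `<=` msupp L `\ G)%fset.
Proof.
move=> GneH HL.
apply/fsubsetP => x; rewrite in_fsetD1 -!mcoeff_neq0 mcoeffB mcoeffZ mcoeffB !mcoeffU.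
have [->|xG] := eqVneq x G.
  rewrite (_ : (H == G) = false); last by apply/eqP => HG; apply: GneH.
  by rewrite mulr1n mulr0n subr0 mulr1 subrr eqxx.
have [<- _|Hx] := eqVneq H x; first by rewrite mcoeff_neq0.
by rewrite !mulr0n subrr mulr0 subr0.
Qed.

(** * The relations lie in the kernel *)

Section RelationsInKernel.
Variable R : realType.

Lemma KerXB_lincomb (A : set (Gt R)) : A `<=` @KerXB R -> lincomb A `<=` @KerXB R.
Proof. by apply: lincomb_min; [exact: KerXB0|exact: KerXBD|exact: KerXBZ]. Qed.

Lemma XBU (G : lgraph) m : XB (<< G >> : Gt R) m = XBgraph R G m.
Proof. by rewrite XBE linextU. Qed.

Lemma XBB (x y : Gt R) m : XB (x - y) m = XB x m - XB y m.
Proof. by rewrite !XBE linearB. Qed.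

Lemma KerXB_iso : @T_iso R `<=` @KerXB R.
Proof.
move=> _ [[G H] /= GH ->] m; apply: etrans (XBB _ _ m) _.
apply/eqP; rewrite subr_eq0; apply/eqP; apply: etrans (XBU G m) _.
by apply: etrans (esym (XBU H m)); rewrite (XBgraph_iso R GH).
Qed.

Lemma KerXB_loop : @T_loop R `<=` @KerXB R.
Proof.
move=> _ [G G_gt0 <-].
apply: (eq_ind _ (fun L => KerXB (Ext L G)) (KerXB_sum G_gt0 _) _
  (sum_loop_shape (@gr R 1) ('X + 1) [:: lab_edge 1 1] [::])) => kappa.
rewrite !big_cons big_nil /weight /= !monochromatic_pair eqxx /=.
by rewrite expr1 expr0; ring.
Qed.

(** If [a] is the weight of the edge, the sum is [(a - 1) * (a - 1 - t)], and [a] is [1] or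
    [1 + t]. *)
Lemma KerXB_multi : @T_multi R `<=` @KerXB R.
Proof.
move=> _ [G G_gt1 <-].
apply: (eq_ind _ (fun L => KerXB (Ext L G)) (KerXB_sum G_gt1 _) _
  (sum_multi_shape (@gr R 2) ('X + 2%:R) ('X + 1)
  [:: lab_edge 1 2; lab_edge 1 2] [:: lab_edge 1 2] [::])) => kappa.
rewrite !big_cons big_nil /weight /= !monochromatic_pair.
by case: eqP => _ /=; ring.
Qed.

(** With [a], [b], [c] the weights of 12, 23, 13, the sum is [(a - c) * (b - 1)]. Either 2 and 3
    have different colours and [b = 1], or they share a colour and [a = c]. *)
Lemma KerXB_osp : @T_osp R `<=` @KerXB R.
Proof.
move=> _ [G G_gt2 <-].
apply: (eq_ind _ (fun L => KerXB (Ext L G)) (KerXB_sum G_gt2 _) _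
  (sum_osp_shape (@gr R 3) [:: lab_edge 1 2; lab_edge 2 3]
  [:: lab_edge 1 3] [:: lab_edge 1 2] [:: lab_edge 1 3; lab_edge 2 3])) => kappa.
rewrite !big_cons big_nil /weight /= !monochromatic_pair.
case: (eqVneq (kappa (inord 0)) (kappa (inord 1))) => [->|k01];
  case: (eqVneq (kappa (inord 1)) (kappa (inord 2))) => [E|k12] /=.
- by ring.
- by ring.
- by rewrite -E (negPf k01) /=; ring.
by case: eqP => _ /=; ring.
Qed.

Lemma KerXB_relspan : @relspan R `<=` @KerXB R.
Proof.
apply: KerXB_lincomb => x [[|]|]; apply: KerXB_lincomb.
- exact: KerXB_iso.
- by move=> y []; [exact: KerXB_loop|exact: KerXB_multi].
exact: KerXB_osp.
Qed.

End RelationsInKernel.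

(** * Linear independence of non-isomorphic star forests *)

Section Independence.
Variable R : realType.

Lemma monic_1DX : (1 + 'X : {poly R[i]}) \is monic.
Proof. by rewrite addrC -[1]polyC1 monicXaddC. Qed.

Lemma size_1DX_exp e : size ((1 + 'X : {poly R[i]}) ^+ e) = e.+1.
Proof. by rewrite addrC -[1]opprK -polyCN size_exp_XsubC. Qed.

Lemma size_mul_1DX_exp (c : {poly R[i]}) e :
  c != 0 -> size (c * (1 + 'X) ^+ e) = (size c + e)%N.
Proof.
move=> c0; rewrite size_Mmonic ?monic_exp ?monic_1DX //.
by rewrite size_1DX_exp addnS.
Qed.

(** As [size] is the degree plus one, the hypothesis bounds the degree of the product by [d]; since
    [1 + 'X] is monic, a coefficient at [d] can only be that of [c]. *)
Lemma coef_mul_1DX_exp (c : {poly R[i]}) e d :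
  c != 0 -> (size c + e <= d.+1)%N ->
  (c * (1 + 'X) ^+ e)`_d = if (size c + e == d.+1)%N then lead_coef c else 0.
Proof.
move=> c0; rewrite leq_eqVlt; case: eqVneq => [E _|_ /= le_d].
  rewrite -[d]/(d.+1.-1) -E -(size_mul_1DX_exp e c0) -lead_coefE.
  by rewrite lead_coef_Mmonic // monic_exp // monic_1DX.
by rewrite nth_default // size_mul_1DX_exp.
Qed.

Lemma star_independent (L : Gt R) :
  star_supported L -> KerXB L ->
  (forall G H, G \in msupp L -> H \in msupp L -> graph_iso G H -> G = H) ->
  L = 0.
Proof.
move=> Lstar LKer Liso; have [L0|/fset0Pn[G1 G1L]] := eqVneq (msupp L) fset0.
  by apply/malgP => G; rewrite mcoeff0 mcoeff_outdom // L0 in_fset0.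
exfalso.
pose D (G : lgraph) := (size L@_G + size (edges G))%N.
have [G0 G0L G0max] : exists2 G0, G0 \in msupp L & forall G, G \in msupp L ->
    (D G <= D G0)%N /\ (D G = D G0 -> size (edges G0) <= size (edges G))%N.
  (* [G2] maximizes [D]; [G0] then has the fewest edges among the maximizers. *)
  pose G2 := [arg max_(G > FSetSub G1L) D (val G)].
  have G2max (G : msupp L) : (D (val G) <= D (val G2))%N.
    by rewrite /G2; case: arg_maxnP => // H _ Hmax; apply: Hmax.
  pose G0 := [arg min_(G < G2 | D (val G) == D (val G2)) size (edges (val G))].
  have [G0D G0min] : D (val G0) = D (val G2) /\ forall G : msupp L,
      D (val G) = D (val G2) -> (size (edges (val G0)) <= size (edges (val G)))%N.
    rewrite /G0; case: arg_minnP => // G /eqP GD Gmin.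
    by split=> // H HD; apply: Gmin; apply/eqP.
  exists (val G0); first exact: valP.
  move=> G GL; rewrite G0D; split; first exact: (G2max (FSetSub GL)).
  exact: (G0min (FSetSub GL)).
have [n [r [rr G0E]]] := Lstar _ G0L.
pose kappa0 : {ffun 'I_n -> nat} := [ffun x => val (r x)].
pose m := colour_monom kappa0.
have szE p (q : 'I_p -> 'I_p) : size (edges (mkgraph (seq_mset (star q)))) = size (leaves q).
  by rewrite -size_star; apply: perm_size; apply: perm_eq_seq_mset.
have deg_m : mdeg m = n.
  rewrite /m /colour_monom mdeg_prod (eq_bigr (fun=> 1%N)) => [|v _]; last exact: mdegU.
  by rewrite sum_nat_const card_ord muln1.
have c0 G : G \in msupp L -> L@_G != 0 by rewrite mcoeff_neq0.
have D_gt0 : (0 < D G0)%N.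
  by rewrite /D addn_gt0 size_poly_gt0 c0.
(* [D] counts the size of the coefficient, one more than its degree, so [d] is the largest degree
   that can occur. *)
pose d := (D G0).-1.
have dS : d.+1 = D G0 by rewrite prednK.
have term0 G : G \in msupp L -> G != G0 -> (L@_G * XBgraph R G m)`_d = 0.
  move=> GL GG0; have [p [q [qq GE]]] := Lstar _ GL.
  have [pn|pn] := eqVneq p n; last first.
    by rewrite XBgraph_homog ?mulr0 ?coef0 // GE deg_m eq_sym.
  subst p; rewrite {2}GE XBgraph_seq mulr_sumr coef_sum.
  rewrite big_seq big1 // => kappa /colouringsP km.
  have [GD Gmin] := G0max _ GL.
  have sz_le : (count (monochromatic kappa) (star q) <= size (leaves q))%N.
    by rewrite -size_star count_size.
  have DGE : D G = (size L@_G + size (leaves q))%N by congr (_ + _)%N; rewrite GE szE.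
  rewrite /weight coef_mul_1DX_exp ?c0 //; last first.
    by rewrite dS; apply: leq_trans GD; rewrite DGE leq_add2l.
  (* A nonzero contribution forces [G] to maximize [D] and all its edges to be monochromatic. Then
     [G] has at least as many edges as [G0], so the two are isomorphic, hence equal by [Liso]. *)
  case: eqP => // E; case/eqP: GG0; apply/esym.
  have count_q : count (monochromatic kappa) (star q) = size (leaves q).
    by move: GD; rewrite -dS -E DGE leq_add2l => ?; apply/eqP; rewrite eqn_leq sz_le.
  have DG : D G = D G0 by rewrite -dS -E DGE count_q.
  apply: Liso => //; rewrite G0E GE; apply: (star_iso_of_colouring rr qq _ km).
    move=> x; have [->//|qx] := eqVneq (q x) x.
    have : all (monochromatic kappa) (star q) by rewrite all_count count_q size_star.
    move=> /allP/(_ (edge_pair x (q x))).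
    rewrite monochromatic_pair (map_f (fun z => edge_pair z (q z))) ?mem_leaves //.
    by move=> /(_ isT) /eqP.
  by move: (Gmin DG); rewrite G0E GE !szE.
have := congr1 (fun p : {poly R[i]} => p`_d) (LKer m).
rewrite /XB coef_sum coef0 (big_fsetD1 _ G0L) /= big_seq big1 => [|G]; last first.
  by rewrite in_fsetD1 => /andP[GG0 GL]; apply: term0.
rewrite addr0 {2}G0E XBgraph_seq mulr_sumr coef_sum.
have DG0E : D G0 = (size L@_G0 + size (leaves r))%N by congr (_ + _)%N; rewrite G0E szE.
have term kappa : (L@_G0 * weight R kappa (star r))`_d =
    if all (monochromatic kappa) (star r) then lead_coef L@_G0 else 0.
  rewrite /weight coef_mul_1DX_exp ?c0 // dS DG0E.
    by rewrite eqn_add2l all_count size_star.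
  by rewrite leq_add2l -size_star count_size.
under eq_bigr do rewrite term.
(* The coefficient is a positive multiple of the leading coefficient at [G0], nonzero in
   characteristic 0, because [kappa0] is among the colourings counted. *)
rewrite -big_mkcond big_const_seq iter_addr_0 => /eqP.
rewrite mulrn_eq0 lead_coef_eq0 (negPf (c0 _ G0L)) orbF -leqn0 leqNgt -has_count.
case/negP; apply/hasP; exists kappa0; first exact/colouringsP.
apply/allP => _ /mapP[x _ ->].
by rewrite monochromatic_pair !ffunE rr.
Qed.

(** Independence needs pairwise non-isomorphic forests, so isomorphic terms are first merged by
    [T_iso], by induction on the size of the support. *)
Lemma KerXB_star_supported (L : Gt R) :
  star_supported L -> KerXB L -> relspan L.
Proof.
have [k] := ubnP #|` msupp L|; elim: k L => // k IH L lt_k Lstar LKer.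
have [[G [H [GL HL GH GneH]]]|Liso] :=
  pselect (exists G H, [/\ G \in msupp L, H \in msupp L, graph_iso G H & G <> H]).
  pose z := L@_G *: (<< G >> - << H >> : Gt R).
  have Rz : relspan z by apply: lincombZ; apply: relspan_iso.
  rewrite -(subrK z L); apply: lincombD; last exact: Rz.
  have supp : (msupp (L - z) `<=` msupp L `\ G)%fset.
    exact: msupp_exchange.
  apply: IH.
  - apply: leq_ltn_trans (fsubset_leq_card supp) _.
    by move: lt_k; rewrite (cardfsD1 G) GL.
  - move=> K /(fsubsetP supp); rewrite in_fsetD1 => /andP[_].
    exact: Lstar.
  apply: KerXBD => //; rewrite -scaleN1r; apply: KerXBZ.
  exact: KerXB_relspan.
rewrite (star_independent Lstar LKer) => [|G H GL HL GH]; first exact: lincomb0.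
by apply: contrapT => GneH; apply: Liso; exists G, H.
Qed.

End Independence.

Theorem theorem12 (R : realType) :
  let I : set (Gt R) := lincomb (@T_iso R) in
  let S1 : set (Gt R) := lincomb (@T_loop R `|` @T_multi R) in
  let S2 : set (Gt R) := lincomb (@T_osp R) in
  lincomb (I `|` S1 `|` S2) = @KerXB R.
Proof.
apply/seteqP; split=> [|L LKer]; first exact: KerXB_relspan.
have [L' L'star RL] := starlikeT L.
rewrite -[L](subrK L'); apply: lincombD; first exact: RL.
apply: KerXB_star_supported => //.
(* The star part [L'] is in the kernel because [L] and the relation [L - L'] are. *)
rewrite -(subKr L L'); apply: KerXBD => //.
by rewrite -scaleN1r; apply/KerXBZ/KerXB_relspan.
Qed.
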